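(* There is a normal tiling of the plane $\mathbb{R}^2$ by pairwise non-congruent convex quadrangles of unit area.
   Context: A tiling of $\mathbb{R}^2$ is a collection $\{T_1, T_2, \ldots\}$ of compact sets $T_i \subset \mathbb{R}^2$ (the tiles) such that the interiors of distinct tiles are disjoint and the union of all tiles equals $\mathbb{R}^2$. Here the tiles are always simple convex polygons. A tiling is normal if there are real numbers $R > r > 0$ such that (1) each tile contains some ball of radius $r$, and (2) each tile is contained in some ball of radius $R$. A quadrangle is a polygon with four vertices. *)

(* Defs.v *)
From HB Require Import structures.
From mathcomp Require Import all_boot all_order all_algebra.
From mathcomp Require Import all_classical all_reals all_analysis.

Set Implicit Arguments.
Unset Strict Implicit.
Unset Printing Implicit Defensive.

Import Order.TTheory GRing.Theory Num.Theory.
Import numFieldNormedType.Exports.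

Local Open Scope classical_set_scope.
Local Open Scope ring_scope.

(* The plane is [R * R], whose library topology is the usual one, but whose
   library norm and balls are those of the sup norm; hence [edist], [disc]. *)
Definition edist (R : realType) (p q : R * R) : R :=
  Num.sqrt ((p.1 - q.1) ^+ 2 + (p.2 - q.2) ^+ 2).

Definition disc (R : realType) (c : R * R) (r : R) : set (R * R) :=
  [set p | edist c p <= r].

Definition area (R : realType) (A : set (R * R)) : \bar R :=
  (lebesgue_measure \x lebesgue_measure)%E A.

(* Reflections are allowed; isometries of the plane are automatically onto. *)
Definition congruent (R : realType) (A B : set (R * R)) : Prop :=
  exists f : R * R -> R * R,
    (forall p q, edist (f p) (f q) = edist p q) /\ f @` A = B.

Definition convex_hull (R : realType) (S : set (R * R)) : set (R * R) :=
  smallest (@convex_set R (R * R)%type) S.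

(* No point lies in the convex hull of the others, so that the [v i] are
   exactly the (pairwise distinct) vertices of their convex hull: there are no
   straight angles. *)
Definition convex_position (R : realType) (n : nat) (v : 'I_n -> R * R) : Prop :=
  forall i, ~ convex_hull (v @` [set j | j != i]) (v i).

(* The convex polygons with exactly [n] vertices, as closed regions; the
   interior condition only excludes the degenerate cases [n <= 2]. *)
Definition convex_polygon (R : realType) (n : nat) (T : set (R * R)) : Prop :=
  T° !=set0 /\
  exists v : 'I_n -> R * R, convex_position v /\ T = convex_hull (range v).

Definition convex_quadrangle (R : realType) (T : set (R * R)) : Prop :=
  convex_polygon 4 T.

Definition tiling (R : realType) (T : nat -> set (R * R)) : Prop :=
  [/\ forall i, compact (T i),
      forall i j, i != j -> (T i)° `&` (T j)° = set0
    & \bigcup_i T i = setT].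

Definition normal_tiling (R : realType) (T : nat -> set (R * R)) : Prop :=
  tiling T /\
  exists r s : R, [/\ 0 < r, r < s,
    forall i, exists c, disc c r `<=` T i
  & forall i, exists c, T i `<=` disc c s].

(* Main.v *)
Require Import Defs.
From mathcomp Require Import all_boot all_order all_algebra.
From mathcomp Require Import all_classical all_reals all_analysis.
From mathcomp Require Import ring lra zify.

(** The strip c <= x <= c + 1 is cut by segments running across it, the i-th one
    having its midpoint at height i and rising by 2 s_i from left to right. Two
    consecutive cuts bound a trapezoid with vertical parallel sides. As long as
    the cuts do not cross, the distance 1 of their midpoints is the mean height
    of the trapezoid, hence its area, the strip having width 1
    ([trapezoid_area]). The strips with c an integer fill the plane, and each of
    them can be cut with its own half-rises s_i, since the tiles of adjacent
    strips need not meet edge to edge.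

    Half-rises with 0 < s_i <= 1/4 keep the cuts apart and the trapezoids
    uniformly fat and bounded, which makes the tiling normal. They also make the
    longest segment in the tile between the cuts of half-rises s and t the
    diagonal from the lower left to the upper right vertex, of length
    sqrt (1 + (1 + s + t)^2) ([trapezoid_diameter], [trapezoid_diagonal]). An
    isometry preserves the diameter, so congruent tiles have the same sum s + t
    ([congruent_trapezoids]).

    It remains to choose the half-rises so that these sums are pairwise distinct.
    All the cuts, indexed by pairs of integers, receive distinct numbers n, and
    the cut of number n receives the half-rise 2^(-n) / 4. A sum of two distinct
    powers of 1/2 determines the two powers ([sum_pow2_pair]), hence the two
    cuts, hence the tile between them ([cell_congruent_inj]). *)

Set Implicit Arguments.
Unset Strict Implicit.
Unset Printing Implicit Defensive.

Local Open Scope classical_set_scope.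
Local Open Scope ring_scope.

Import Order.TTheory GRing.Theory Num.Theory.
Import numFieldNormedType.Exports.

(** * Half-planes and convex hulls *)

Definition halfplane (R : realType) (a b d : R) : set (R * R) :=
  [set p | 0 <= a * p.1 + b * p.2 + d].

Lemma halfplane_closed (R : realType) (a b d : R) :
  closed (halfplane a b d).
Proof.
apply: (@preimage_closed _ _ (fun p : R * R => a * p.1 + b * p.2 + d)
  [set x | 0 <= x]); last exact: closed_ge.
move=> p _; apply: cvgD; last exact: cvg_cst.
apply: cvgD; apply: cvgM; [exact: cvg_cst | exact: cvg_fst |
  exact: cvg_cst | exact: cvg_snd].
Qed.

Lemma halfplane_convex (R : realType) (a b d : R) :
  @convex_set R (R * R)%type (halfplane a b d).
Proof.
move=> p q l; rewrite !inE /halfplane /= => hp hq.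
have -> : a * (l%:num * p.1 + unstable.onem l%:num * q.1)
    + b * (l%:num * p.2 + unstable.onem l%:num * q.2) + d =
  l%:num * (a * p.1 + b * p.2 + d)
    + unstable.onem l%:num * (a * q.1 + b * q.2 + d).
  by rewrite /unstable.onem; ring.
by rewrite addr_ge0 // mulr_ge0 // unstable.onem_ge0.
Qed.

Lemma convex_setI (R : realType) (A B : set (R * R)) :
  @convex_set R (R * R)%type A -> @convex_set R (R * R)%type B ->
  @convex_set R (R * R)%type (A `&` B).
Proof.
move=> cA cB p q l; rewrite !in_setI => /andP[Ap Bp] /andP[Aq Bq].
by apply/andP; split; [exact: cA | exact: cB].
Qed.

(** Convexity with the coordinates of the intermediate point spelled out, so
    that the equations can be left to [ring] and [lra]. *)
Lemma convex_set_segment (R : realType) (A : set (R * R)) (p q z : R * R)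
    (l : R) :
  @convex_set R (R * R)%type A -> A p -> A q -> 0 <= l -> l <= 1 ->
  z.1 = l * p.1 + (1 - l) * q.1 -> z.2 = l * p.2 + (1 - l) * q.2 -> A z.
Proof.
case: z => z1 z2 cA Ap Aq l0 l1 /= -> ->.
by have := cA p q (Itv01 l0 l1); rewrite !inE; apply.
Qed.

(** Half-planes are convex, so one of them that contains S and misses p separates
    p from the hull of S; this is how vertices are recognized. *)
Lemma halfplane_hullN (R : realType) (S : set (R * R)) (a b d : R)
    (p : R * R) :
  S `<=` halfplane a b d -> a * p.1 + b * p.2 + d < 0 -> ~ convex_hull S p.
Proof.
move=> Sh pN /(smallest_sub (@halfplane_convex R a b d) Sh).
by rewrite /halfplane /= leNgt pN.
Qed.

(** * A family of unit-area trapezoids *)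

(** The region of the strip [c, c + 1] between the segment from (c, h - s) to
    (c + 1, h + s) and the segment from (c, h + 1 - t) to (c + 1, h + 1 + t): the
    factor 2 (x - c) - 1 runs from -1 to 1 as x crosses the strip, so s and t are
    half the rises of the two sides. *)
Definition trapezoid (R : realType) (c h s t : R) : set (R * R) :=
  [set p | [/\ c <= p.1, p.1 <= c + 1,
               h + s * (2 * (p.1 - c) - 1) <= p.2 &
               p.2 <= h + 1 + t * (2 * (p.1 - c) - 1)]].

Lemma trapezoidE (R : realType) (c h s t : R) :
  trapezoid c h s t =
  halfplane 1 0 (- c) `&` halfplane (- 1) 0 (c + 1) `&`
  (halfplane (- 2 * s) 1 (s * (2 * c + 1) - h) `&`
   halfplane (2 * t) (- 1) (h + 1 - t * (2 * c + 1))).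
Proof.
apply/seteqP; split => -[x y]; rewrite /trapezoid /halfplane /=.
  by case=> *; do 2?split; lra.
by case=> -[? ?] [? ?]; split; lra.
Qed.

Lemma trapezoid_convex (R : realType) (c h s t : R) :
  @convex_set R (R * R)%type (trapezoid c h s t).
Proof.
rewrite trapezoidE; do 2?apply: convex_setI; exact: halfplane_convex.
Qed.

Lemma tilt_bound (R : realType) (s u : R) : 0 <= s -> 0 <= u <= 1 ->
  - s <= s * (2 * u - 1) <= s.
Proof. by move=> s0 /andP[u0 u1]; apply/andP; split; nra. Qed.

Lemma trapezoid_height (R : realType) (c h s t : R) (p : R * R) :
  0 <= s -> 0 <= t -> trapezoid c h s t p -> h - s <= p.2 <= h + 1 + t.
Proof.
case: p => x y s0 t0 [/= x0 x1 yl yu].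
have x01 : 0 <= x - c <= 1 by apply/andP; split; lra.
have /andP[sl su] := tilt_bound s0 x01.
have /andP[tl tu] := tilt_bound t0 x01.
by apply/andP; split; lra.
Qed.

Lemma trapezoid_compact (R : realType) (c h s t : R) :
  0 <= s -> 0 <= t -> compact (trapezoid c h s t).
Proof.
move=> s0 t0.
apply: (@subclosed_compact _ _ (`[c, c + 1] `*` `[h - s, h + 1 + t])).
- by rewrite trapezoidE; do 2?apply: closedI; exact: halfplane_closed.
- by apply: compact_setX; exact: segment_compact.
- move=> p Tp; have := trapezoid_height s0 t0 Tp.
  by case: Tp => x0 x1 _ _ yb; rewrite /= !in_itv /= x0 x1 yb.
Qed.

(** A point of the interior can be moved a little horizontally and vertically
    without leaving the trapezoid; horizontal moves make the bounds on x strict,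
    vertical ones those on y. *)
Lemma trapezoid_interior (R : realType) (c h s t : R) (p : R * R) :
  (trapezoid c h s t)° p ->
  [/\ c < p.1, p.1 < c + 1,
      h + s * (2 * (p.1 - c) - 1) < p.2 &
      p.2 < h + 1 + t * (2 * (p.1 - c) - 1)].
Proof.
case: p => x y /nbhs_ballP[e /= e0 sub].
have e20 : 0 < e / 2 by lra.
have e2e : e / 2 < e by lra.
have step (dx dy : R) : `|dx| < e -> `|dy| < e ->
    trapezoid c h s t (x + dx, y + dy).
  move=> xe ye; apply: sub; split => /=;
  by rewrite /ball /= opprD addrA subrr sub0r normrN.
have n0 : `|0 : R| < e by rewrite normr0.
have np : `|e / 2| < e by rewrite gtr0_norm.
have nn : `|- (e / 2)| < e by rewrite normrN gtr0_norm.
have [_ xr _ _] := step _ _ np n0.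
have [xl _ _ _] := step _ _ nn n0.
have [_ _ _ yu] := step _ _ n0 np.
have [_ _ yl _] := step _ _ n0 nn.
by move: xr xl yu yl; rewrite /= ?addr0 => *; split; lra.
Qed.

Lemma disc_sub_trapezoid (R : realType) (c h s t : R) :
  0 <= s -> s <= 4^-1 -> 0 <= t -> t <= 4^-1 ->
  disc (c + 2^-1, h + 2^-1) 4^-1 `<=` trapezoid c h s t.
Proof.
move=> s0 s4 t0 t4 [x y]; rewrite /disc /Defs.edist /= => le4.
have {le4} : (c + 2^-1 - x) ^+ 2 + (h + 2^-1 - y) ^+ 2 <= 4^-1 ^+ 2.
  by rewrite -ler_sqrt ?sqr_ge0 // sqrtr_sqr ger0_norm //; lra.
rewrite !expr2 => le4.
have ? : 0 <= (c + 2^-1 - x) * (c + 2^-1 - x) by rewrite -expr2 sqr_ge0.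
have ? : 0 <= (h + 2^-1 - y) * (h + 2^-1 - y) by rewrite -expr2 sqr_ge0.
have [? ?] : c + 2^-1 - x <= 4^-1 /\ - 4^-1 <= c + 2^-1 - x by split; nra.
have [? ?] : h + 2^-1 - y <= 4^-1 /\ - 4^-1 <= h + 2^-1 - y by split; nra.
have x01 : 0 <= x - c <= 1 by apply/andP; split; lra.
have /andP[sl su] := tilt_bound s0 x01.
have /andP[tl tu] := tilt_bound t0 x01.
by split => /=; lra.
Qed.

Lemma trapezoid_sub_disc (R : realType) (c h s t : R) :
  0 <= s -> s <= 4^-1 -> 0 <= t -> t <= 4^-1 ->
  trapezoid c h s t `<=` disc (c + 2^-1, h + 2^-1) 2.
Proof.
move=> s0 s4 t0 t4 [x y] T; have := trapezoid_height s0 t0 T.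
case: T => /= x0 x1 _ _ /andP[y0 y1]; rewrite /disc /Defs.edist /=.
rewrite -[leRHS]ger0_norm // -sqrtr_sqr ler_wsqrtr // !expr2.
have ? : (c + 2^-1 - x) * (c + 2^-1 - x) <= 1 by nra.
have ? : (h + 2^-1 - y) * (h + 2^-1 - y) <= 1 by nra.
rewrite /=; lra.
Qed.

(** The bound is the diagonal of the bounding box, which has width 1 and, as s
    and t are nonnegative, height 1 + s + t. *)
Lemma trapezoid_diameter (R : realType) (c h s t : R) (p q : R * R) :
  0 <= s -> 0 <= t -> trapezoid c h s t p -> trapezoid c h s t q ->
  Defs.edist p q <= Num.sqrt (1 + (1 + (s + t)) ^+ 2).
Proof.
move=> s0 t0 Tp Tq.
have := trapezoid_height s0 t0 Tp.
have := trapezoid_height s0 t0 Tq.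
case: p q Tp Tq => x y [x' y'] [/= ? ? _ _] [/= ? ? _ _].
move=> /andP[? ?] /andP[? ?]; rewrite /Defs.edist /= ler_wsqrtr //.
have sq (d k : R) : - k <= d -> d <= k -> d ^+ 2 <= k ^+ 2.
  by move=> ? ?; rewrite !expr2; nra.
by apply: lerD; [rewrite -(expr1n _ 2)|]; apply: sq; lra.
Qed.

(** The diameter bound is attained: the lower left and upper right vertices are
    opposite corners of the bounding box. *)
Lemma trapezoid_diagonal (R : realType) (c h s t : R) :
  0 <= s -> s <= 4^-1 -> 0 <= t -> t <= 4^-1 ->
  exists p q, [/\ trapezoid c h s t p, trapezoid c h s t q &
    Defs.edist p q = Num.sqrt (1 + (1 + (s + t)) ^+ 2)].
Proof.
move=> s0 s4 t0 t4; exists (c, h - s), (c + 1, h + 1 + t).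
split; [by split => /=; lra | by split => /=; lra |].
by rewrite /Defs.edist /=; congr Num.sqrt; ring.
Qed.

(** The diameter, an increasing function of s + t, is a congruence invariant.
    For one inequality the longest diagonal of the first trapezoid is carried to
    the second by f; for the other, the endpoints of the longest diagonal of the
    second are pulled back to the first, which f maps onto it. *)
Lemma congruent_trapezoids (R : realType) (c h s t c' h' s' t' : R) :
  0 <= s -> s <= 4^-1 -> 0 <= t -> t <= 4^-1 ->
  0 <= s' -> s' <= 4^-1 -> 0 <= t' -> t' <= 4^-1 ->
  congruent (trapezoid c h s t) (trapezoid c' h' s' t') ->
  s + t = s' + t'.
Proof.
move=> s0 s4 t0 t4 s0' s4' t0' t4' [f [fd fT]].
have le_diag (a b : R) : 0 <= a -> 0 <= b ->
    Num.sqrt (1 + (1 + a) ^+ 2) <= Num.sqrt (1 + (1 + b) ^+ 2) -> a <= b.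
  move=> a0 b0; rewrite ler_sqrt ?addr_ge0 ?sqr_ge0 // lerD2l.
  by rewrite ler_sqr ?nnegrE; lra.
apply: le_anti; apply/andP; split; apply: le_diag; try lra.
  have [p [q [Tp Tq <-]]] := trapezoid_diagonal c h s0 s4 t0 t4.
  rewrite -fd; apply: (@trapezoid_diameter R c' h') => //;
  by rewrite -fT; exact: imageP.
have [p [q [Tp Tq <-]]] := trapezoid_diagonal c' h' s0' s4' t0' t4'.
move: Tp Tq; rewrite -fT => -[p0 Tp0 <-] [q0 Tq0 <-]; rewrite fd.
exact: (@trapezoid_diameter R c h).
Qed.

(** The vertical section at x has length g x = 1 + (t - s) (2 (x - c) - 1), whose
    deviation from 1 is odd about the middle of the strip; F is a primitive of g
    with F (c + 1) - F c = 1. *)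
Lemma trapezoid_area (R : realType) (c h s t : R) :
  0 <= s -> s <= 4^-1 -> 0 <= t -> t <= 4^-1 ->
  area (trapezoid c h s t) = 1%:E.
Proof.
move=> s0 s4 t0 t4; rewrite /area /product_measure1.
pose g (x : R) := 1 + (t - s) * (2 * (x - c) - 1).
have -> : (lebesgue_measure \o xsection (trapezoid c h s t)) =
    ((EFin \o g) \_ `[c, c + 1]).
  apply/funext => x; rewrite patchE; case: ifPn => xI.
    move: (xI); rewrite inE /= in_itv /= => /andP[x0 x1].
    have -> : xsection (trapezoid c h s t) x =
      [set` `[h + s * (2 * (x - c) - 1), h + 1 + t * (2 * (x - c) - 1)]].
      apply/seteqP; split => y; rewrite /xsection /= in_setE in_itv /=.
        by case=> _ _ /= -> ->.
      by move=> /andP[? ?]; split.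
    have x01 : 0 <= x - c <= 1 by apply/andP; split; lra.
    have /andP[sl su] := tilt_bound s0 x01.
    have /andP[tl tu] := tilt_bound t0 x01.
    rewrite /= lebesgue_measure_itv /= lte_fin ifT; last by lra.
    by rewrite -EFinB; congr EFin; rewrite /g; ring.
  rewrite /= (_ : xsection _ x = set0) ?measure0 //.
  apply/seteqP; split => y //; rewrite /xsection /= in_setE => -[/= x0 x1 _ _].
  by move: xI; rewrite notin_setE /= in_itv /= x0 x1 => /(_ isT).
rewrite -integral_mkcond.
pose F (x : R) := x + (t - s) * ((x - c) ^+ 2 - (x - c)).
have dF (x : R) : is_derive x 1 F (g x).
  rewrite /F; apply: is_derive_eq; rewrite /g /GRing.scale /=; ring.
have dg (x : R) : is_derive x 1 g ((t - s) * 2).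
  rewrite /g; apply: is_derive_eq; rewrite /GRing.scale /=; ring.
have cts (f : R -> R) (f' : R -> R) :
    (forall x : R, is_derive x 1 f (f' x)) -> continuous f.
  by move=> df x; apply: differentiable_continuous; apply/derivable1_diffP.
rewrite (@continuous_FTC2 _ g F).
- by rewrite -EFinB /F; congr EFin; ring.
- lra.
- by apply: continuous_subspaceT; apply: cts.
- split; first by move=> x _; exact: ex_derive.
  + by apply: cvg_at_right_filter; apply: (cts F g).
  + by apply: cvg_at_left_filter; apply: (cts F g).
- by move=> x _; rewrite derive1E; exact: derive_val.
Qed.

(** The lower left and upper right vertices are the unique lowest and highest
    ones, which needs s and t positive; the other two are the unique extreme
    vertices in the direction (1, -1) and its opposite, as s, t <= 1/4 makes the
    trapezoid close enough to the unit square. For the hull, a point is reached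
    from the two points vertically below and above it on the slanted sides. *)
Lemma trapezoid_quadrangle (R : realType) (c h s t : R) :
  0 < s -> s <= 4^-1 -> 0 < t -> t <= 4^-1 ->
  convex_quadrangle (trapezoid c h s t).
Proof.
move=> s0 s4 t0 t4; split.
  exists (c + 2^-1, h + 2^-1); apply/nbhs_ballP; exists 8^-1 => /=; first by lra.
  move=> [x y] [/=]; rewrite /ball /= !ltr_norml => /andP[? ?] /andP[? ?].
  have x01 : 0 <= x - c <= 1 by apply/andP; split; lra.
  have /andP[sl su] := tilt_bound (ltW s0) x01.
  have /andP[tl tu] := tilt_bound (ltW t0) x01.
  by split => /=; lra.
pose A : R * R := (c, h - s).
pose B : R * R := (c, h + 1 - t).
pose C : R * R := (c + 1, h + 1 + t).
pose D : R * R := (c + 1, h + s).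
pose v (i : 'I_4) := nth A [:: A; B; C; D] i.
exists v; split.
  (* The half-planes y >= h, x - y >= c - h - 1/4, y <= h + 1 and
     x - y <= c - h + 1/4 cut off A, B, C and D respectively. *)
  case=> [[|[|[|[|//]]]] lti] /=.
  - apply: (@halfplane_hullN R _ 0 1 (- h)); last by rewrite /v /=; lra.
    by move=> _ [[[|[|[|[|//]]]] j] /= ji <-] //; rewrite /v /halfplane /=; lra.
  - apply: (@halfplane_hullN R _ 1 (- 1) (h - c + 4^-1)); last by rewrite /v /=; lra.
    by move=> _ [[[|[|[|[|//]]]] j] /= ji <-] //; rewrite /v /halfplane /=; lra.
  - apply: (@halfplane_hullN R _ 0 (- 1) (h + 1)); last by rewrite /v /=; lra.
    by move=> _ [[[|[|[|[|//]]]] j] /= ji <-] //; rewrite /v /halfplane /=; lra.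
  - apply: (@halfplane_hullN R _ (- 1) 1 (c - h + 4^-1)); last by rewrite /v /=; lra.
    by move=> _ [[[|[|[|[|//]]]] j] /= ji <-] //; rewrite /v /halfplane /=; lra.
apply/seteqP; split; last first.
  apply: smallest_sub; first exact: trapezoid_convex.
  by move=> _ [[[|[|[|[|//]]]] j] _ <-]; rewrite /v; split => /=; lra.
move=> [x y] [/= x0 x1 yl yu] H [cH vH].
have HA : H A by apply: vH; exists (@Ordinal 4 0 isT).
have HB : H B by apply: vH; exists (@Ordinal 4 1 isT).
have HC : H C by apply: vH; exists (@Ordinal 4 2 isT).
have HD : H D by apply: vH; exists (@Ordinal 4 3 isT).
have x01 : 0 <= x - c <= 1 by apply/andP; split; lra.
have /andP[sl su] := tilt_bound (ltW s0) x01.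
have /andP[tl tu] := tilt_bound (ltW t0) x01.
set lo := h + s * (2 * (x - c) - 1) in yl.
set up := h + 1 + t * (2 * (x - c) - 1) in yu.
have Hlo : H (x, lo).
  apply: (@convex_set_segment R H D A _ (x - c)) => //=; rewrite /lo; lra.
have Hup : H (x, up).
  apply: (@convex_set_segment R H C B _ (x - c)) => //=; rewrite /up; lra.
have lu : 0 < up - lo by rewrite /up /lo; lra.
apply: (@convex_set_segment R H (x, up) (x, lo) _ ((y - lo) / (up - lo))) => //=.
- by rewrite divr_ge0 //; lra.
- by rewrite ler_pdivrMr //; lra.
- by field; lra.
- by field; lra.
Qed.

(** * Numbering pairs of integers, and sums of two powers of 1/2 *)

Lemma int2_enum : exists (g : nat -> int * int) (r : int * int -> nat),
  cancel g r /\ cancel r g.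
Proof.
have inf : infinite_set [set: int * int].
  move=> fin; apply: infinite_nat.
  rewrite -(preimage_setT (fun n : nat => (Posz n, Posz 0))).
  by apply: finite_preimage fin => m n _ _ [].
have /card_set_bijP[r] := eq_card_nat (countableP _) inf.
rewrite setTT_bijective => -[g rg gr].
by exists g, r.
Qed.

(** The right-hand side is at most 3/2 * 2^(-c); if a < c, this is at most
    3/4 * 2^(-a), less than the left-hand side. *)
Lemma sum_pow2_le (R : realType) (a b c d : nat) : (a < b)%N ->
  (c < d)%N -> (2^-1 : R) ^+ a + 2^-1 ^+ b = 2^-1 ^+ c + 2^-1 ^+ d ->
  (c <= a)%N.
Proof.
move=> ab cd e; rewrite leqNgt; apply/negP => ac.
have mono (m n : nat) : (m < n)%N -> (2^-1 : R) ^+ n <= 2^-1 * 2^-1 ^+ m.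
  by move=> mn; rewrite -exprS ler_wiXn2l //; lra.
have p0 (n : nat) : 0 < (2^-1 : R) ^+ n by rewrite exprn_gt0 //; lra.
move: (mono _ _ ac) (mono _ _ cd) (p0 a) (p0 b); lra.
Qed.

Lemma sum_pow2_inj (R : realType) (a b c d : nat) : (a < b)%N ->
  (c < d)%N -> (2^-1 : R) ^+ a + 2^-1 ^+ b = 2^-1 ^+ c + 2^-1 ^+ d ->
  a = c /\ b = d.
Proof.
move=> ab cd e.
have ac : a = c.
  apply/eqP; rewrite eqn_leq (sum_pow2_le ab cd e).
  by rewrite (sum_pow2_le cd ab (esym e)).
split=> //; apply: (@ieexprIn R 2^-1); [lra | lra |].
by move: e; rewrite ac; apply: addrI.
Qed.

Lemma sum_pow2_pair (R : realType) (a b c d : nat) : a != b -> c != d ->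
  (2^-1 : R) ^+ a + 2^-1 ^+ b = 2^-1 ^+ c + 2^-1 ^+ d ->
  (a = c /\ b = d) \/ (a = d /\ b = c).
Proof.
move=> /[swap]; rewrite !neq_ltn => /orP[cd|dc] /orP[ab|ba] e.
- by left; exact: sum_pow2_inj e.
- by right; move: e; rewrite addrC => /(sum_pow2_inj ba cd)[].
- by right; move: e; rewrite [RHS]addrC => /(sum_pow2_inj ab dc)[].
- by left; move: e; rewrite addrC [RHS]addrC => /(sum_pow2_inj ba dc)[].
Qed.

(** * The tiling *)

(** Half the rise of the lower side of the cell z, also the upper side of the cell
    below it in the same strip. The factor 1/4 is what keeps the cuts apart and
    makes [trapezoid_quadrangle] apply. *)
Definition half_rise (R : realType) (r : int * int -> nat) (z : int * int) : R :=
  4^-1 * 2^-1 ^+ r z.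

(** The pair z = (k, i) numbers the strip and the position in it. *)
Definition cell (R : realType) (r : int * int -> nat) (z : int * int) :
    set (R * R) :=
  trapezoid z.1%:~R z.2%:~R (half_rise R r z) (half_rise R r (z.1, z.2 + 1)).

Lemma half_rise_gt0 (R : realType) (r : int * int -> nat) (z : int * int) :
  0 < half_rise R r z.
Proof. by rewrite /half_rise mulr_gt0 ?exprn_gt0 //; lra. Qed.

Lemma half_rise_le (R : realType) (r : int * int -> nat) (z : int * int) :
  half_rise R r z <= 4^-1.
Proof.
rewrite /half_rise; have : (2^-1 : R) ^+ r z <= 1 by rewrite exprn_ile1 //; lra.
lra.
Qed.

Lemma half_rise_bound (R : realType) (r : int * int -> nat) (z : int * int)
    (u : R) : 0 <= u <= 1 -> - 4^-1 <= half_rise R r z * (2 * u - 1) <= 4^-1.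
Proof.
move=> /(tilt_bound (ltW (half_rise_gt0 R r z)))/andP[? ?].
by have ? := half_rise_le R r z; apply/andP; split; lra.
Qed.

(** The vertical strip of a point is found by rounding down its abscissa. Since
    a cut strays by at most 1/4 from its integer mean height, the cell of the
    point in that strip is one of three: the one suggested by rounding down the
    ordinate, or a neighbour of it. *)
Lemma cell_cover (R : realType) (r : int * int -> nat) (p : R * R) :
  exists z, cell r z p.
Proof.
case: p => x y; set k := Num.floor x; set j := Num.floor y.
have /andP[k0] := floor_itv x; have /andP[j0] := floor_itv y.
rewrite !intrD -/k -/j => j1 k1.
have x01 : 0 <= x - k%:~R <= 1 by apply/andP; split; lra.
have bound i := half_rise_bound r (k, i) x01.
(* L i is the height, above x, of the cut shared by the cells i - 1 and i. *)
set L := fun i : int => i%:~R + half_rise R r (k, i) * (2 * (x - k%:~R) - 1).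
have intro i : L i <= y -> y <= L (i + 1) -> exists z, cell r z (x, y).
  move=> lo up; exists (k, i); split => //=; first by lra.
  by move: up; rewrite /L intrD.
have [yj|jy] := leP y (L j).
  apply: (intro (j - 1)); last by rewrite subrK.
  by have /andP[_ ?] := bound (j - 1); rewrite /L intrB; lra.
have [yj1|j1y] := leP y (L (j + 1)); first by apply: (intro j) => //; exact: ltW.
apply: (intro (j + 1)); first exact: ltW.
by have /andP[? _] := bound (j + 1 + 1); rewrite /L !intrD; lra.
Qed.

Lemma cell_interior_inj (R : realType) (r : int * int -> nat)
    (z z' : int * int) (p : R * R) :
  (cell r z)° p -> (cell r z')° p -> z = z'.
Proof.
have int_le (m n : int) (x : R) : m%:~R < x -> x < n%:~R + 1 -> m <= n.
  move=> mx xn; rewrite -ltzD1 -(ltr_int R) intrD; exact: lt_trans mx xn.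
case: z z' p => k i [k' i'] [x y].
move=> /trapezoid_interior[/= kx xk il iu].
move=> /trapezoid_interior[/= kx' xk' il' iu'].
have kk' : k = k'.
  by apply: le_anti; rewrite (int_le k k' x) ?(int_le k' k x).
subst k'.
have x01 : 0 <= x - k%:~R <= 1 by apply/andP; split; lra.
have bound n := half_rise_bound r (k, n) x01.
(* Consecutive cuts of a strip stay at least 1/2 apart, so the cuts are ordered
   like their indices. *)
have sep (m n : int) :
    m%:~R + half_rise R r (k, m) * (2 * (x - k%:~R) - 1) < y ->
    y < n%:~R + 1 + half_rise R r (k, n + 1) * (2 * (x - k%:~R) - 1) -> m <= n.
  move=> lo up; rewrite leNgt; apply/negP; rewrite -lezD1 le_eqVlt => /orP[/eqP nm|nm].
    by move: lo up; rewrite -nm intrD; lra.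
  have : (n + 1 + 1)%:~R <= m%:~R :> R by rewrite ler_int lezD1.
  rewrite !intrD; have /andP[? _] := bound m; have /andP[_ ?] := bound (n + 1).
  lra.
by congr pair; apply: le_anti; rewrite (sep i i') ?(sep i' i).
Qed.

(** The sum of the two half-rises of a cell recovers the unordered pair of
    consecutive cuts that bound it; the pair cannot be matched in the wrong
    order, as i = i' + 1 and i + 1 = i' are incompatible. *)
Lemma cell_congruent_inj (R : realType) (r : int * int -> nat)
    (z z' : int * int) :
  injective r -> congruent (cell r z : set (R * R)) (cell r z') -> z = z'.
Proof.
case: z z' => k i [k' i'] rI.
have s0 z := ltW (half_rise_gt0 R r z); have s4 := half_rise_le R r.
move=> /congruent_trapezoids.
move=> /(_ (s0 _) (s4 _) (s0 _) (s4 _) (s0 _) (s4 _) (s0 _) (s4 _)) /=.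
have q0 : (4^-1 : R) != 0 by rewrite invr_neq0.
rewrite /half_rise -!mulrDr => /(mulfI q0) e.
have ne n m : r (n, m) != r (n, m + 1).
  by apply/eqP => /rI[] /eqP; rewrite -subr_eq0 opprD addrA subrr.
have [[/rI -> //]|[/rI[_ ii'] /rI[_ i'i]]] := sum_pow2_pair (ne _ _) (ne _ _) e.
by exfalso; lia.
Qed.

Theorem theorem1 (R : realType) :
  exists T : nat -> set (R * R),
    [/\ normal_tiling T,
        forall i : nat, convex_quadrangle (T i),
        forall i : nat, area (T i) = 1%:E
      & forall i j : nat, i != j -> ~ congruent (T i) (T j)].
Proof.
have [g [r [gr rg]]] := int2_enum.
have s0 z := ltW (half_rise_gt0 R r z); have s4 := half_rise_le R r.
exists (fun n => cell r (g n)); split.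
- split; last first.
    exists 4^-1, 2; split; [lra | lra | |] => n.
      by eexists; exact: disc_sub_trapezoid.
    by eexists; exact: trapezoid_sub_disc.
  split.
  + by move=> n; exact: trapezoid_compact.
  + move=> m n mn; apply/seteqP; split => // p [Tm Tn].
    move: mn => /eqP; apply; apply: (can_inj gr).
    exact: cell_interior_inj Tm Tn.
  + apply/seteqP; split => // p _; have [z Tz] := cell_cover r p.
    by exists (r z); rewrite ?rg.
- by move=> n; apply: trapezoid_quadrangle; rewrite ?half_rise_gt0.
- by move=> n; exact: trapezoid_area.
- move=> m n /eqP mn /(cell_congruent_inj (can_inj rg)) /(can_inj gr); exact: mn.
Qed.
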